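(* Let $\mu\ge1$ and $m\ge1$ be integers. Define power series (functions of $t$ near $0$) recursively by $F_1(t)=-\log E_m(-t)$ and $F_{j+1}(t)=\int_0^t\frac{E_{m-1}(-s)}{1-E_m(-s)}F_j(s)\,ds$ for $j\ge1$, and similarly $G_1(t)=-\log\bigl(1+e^{-t}-E_{m-1}(-t)\bigr)$ and $G_{j+1}(t)=\int_0^t\frac{e^{-s}-E_{m-2}(-s)}{E_{m-1}(-s)-e^{-s}}G_j(s)\,ds$ for $j\ge1$. Then $$\frac{F_\mu(t)}{1-E_m(-t)}=\sum_{n=0}^\infty B_{n,\le m}^{(\mu)}\frac{t^n}{n!}\qquad\text{and}\qquad \frac{G_\mu(t)}{E_{m-1}(-t)-e^{-t}}=\sum_{n=0}^\infty B_{n,\ge m}^{(\mu)}\frac{t^n}{n!}.$$ (Equivalently, the left-hand sides are the $(\mu-1)$-fold iterated integrals $\frac{1}{1-E_m(-t)}\int_0^t\frac{E_{m-1}(-t)}{1-E_m(-t)}\int_0^t\cdots\frac{E_{m-1}(-t)}{1-E_m(-t)}\bigl(-\log E_m(-t)\bigr)\,dt\cdots dt$ and the analogous expression for the associated case.)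
   Context: $E_m(t)=\sum_{k=0}^m \frac{t^k}{k!}$ for $m\ge0$, and by convention $E_{-1}(t)=0$. For integers $n,k\ge0$, $m\ge1$, $\left\{ {n \atop k} \right\}_{\le m}$ (resp. $\left\{ {n \atop k} \right\}_{\ge m}$) is the number of partitions of an $n$-element set into $k$ nonempty blocks each of size at most $m$ (resp. at least $m$), with the value $1$ for $n=k=0$. The restricted and associated poly-Bernoulli numbers are $$B_{n,\le m}^{(\mu)}=\sum_{k=0}^n(-1)^{n-k}\frac{k!}{(k+1)^\mu}\left\{ {n \atop k} \right\}_{\le m},\qquad B_{n,\ge m}^{(\mu)}=\sum_{k=0}^n(-1)^{n-k}\frac{k!}{(k+1)^\mu}\left\{ {n \atop k} \right\}_{\ge m}\qquad(n\ge0).$$ *)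

(* Defs.v *)
(* Stdlib reals with Coquelicot; MathComp's finite sets are used only to count
   set partitions. *)
From Stdlib Require Import Reals ZArith.
From Coquelicot Require Import Coquelicot.
From mathcomp Require Import all_boot.

Set Implicit Arguments.
Unset Strict Implicit.
Unset Printing Implicit Defensive.

Open Scope R_scope.

(* The index is an integer so that E_{m-2} is E_{-1} = 0 when m = 1, instead of
   being truncated to E_0. *)
Definition Epoly (m : Z) (t : R) : R :=
  if (m <? 0)%Z then 0
  else sum_n (fun k : nat => t ^ k / INR (fact k)) (Z.to_nat m).

Definition part_le (m n k : nat) : nat :=
  #|[set P : {set {set 'I_n}} |
      [&& partition P [set: 'I_n], #|P| == k
        & [forall B in P, (#|B| <= m)%N]]]|.

Definition part_ge (m n k : nat) : nat :=
  #|[set P : {set {set 'I_n}} |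
      [&& partition P [set: 'I_n], #|P| == k
        & [forall B in P, (m <= #|B|)%N]]]|.

Definition Bernoulli_le (m mu n : nat) : R :=
  sum_n (fun k : nat =>
    (-1) ^ (n - k) * (INR (fact k) / INR (k + 1) ^ mu) * INR (part_le m n k)) n.

Definition Bernoulli_ge (m mu n : nat) : R :=
  sum_n (fun k : nat =>
    (-1) ^ (n - k) * (INR (fact k) / INR (k + 1) ^ mu) * INR (part_ge m n k)) n.

(* The families are indexed from 1; the value at index 0 is a dummy. The
   integrands have a removable singularity at s = 0, whose value there does not
   affect the Riemann integral. *)
Fixpoint Fres (m j : nat) (t : R) {struct j} : R :=
  let z := Z.of_nat m in
  match j with
  | O => 0
  | S i =>
      match i with
      | O => - ln (Epoly z (- t))
      | S _ =>
          RInt (fun s => Epoly (z - 1) (- s) / (1 - Epoly z (- s)) * Fres m i s)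
               0 t
      end
  end.

Fixpoint Gassoc (m j : nat) (t : R) {struct j} : R :=
  let z := Z.of_nat m in
  match j with
  | O => 0
  | S i =>
      match i with
      | O => - ln (1 + exp (- t) - Epoly (z - 1) (- t))
      | S _ =>
          RInt (fun s => (exp (- s) - Epoly (z - 2) (- s))
                           / (Epoly (z - 1) (- s) - exp (- s)) * Gassoc m i s)
               0 t
      end
  end.

(* Main.v *)
(* Put u(t) = 1 - E_m(-t), resp. u(t) = E_{m-1}(-t) - e^{-t}: up to sign this is
   the exponential generating function of the admissible block sizes at -t.
   Since Li_{j+1}'(x) = Li_j(x) / x, the iterated integrals are Li_j(u(t)), so
   that F_j / u = sum_k u^k / (k+1)^j.  The n-th coefficient of u^k is
   (-1)^(n-k) k! / n! times the number of partitions of an n-set into k admissible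
   blocks, because choosing a block B of a partition of A into k+1 blocks leaves a
   partition of A \ B into k blocks, which is the Cauchy product by u on
   coefficients.  The coefficients of u are at most 1 in absolute value and u(0) = 0,
   hence those of u^k are at most 2^n for every k, and the double series may be
   rearranged near 0. *)
Require Import Defs.
From Stdlib Require Import Reals ZArith Lia Lra.
From Coquelicot Require Import Coquelicot.
From mathcomp Require Import all_boot zify.

Open Scope R_scope.

(** * Counting set partitions *)

Definition set_parts {T : finType} (p : pred nat) (A : {set T}) (k : nat) :
    {set {set {set T}}} :=
  [set P | [&& partition P A, #|P| == k & [forall B in P, p #|B|]]].

(** Size [0] is excluded whatever [p] says, because the blocks of a partition are nonempty. *)
Definition block_size (p : pred nat) (i : nat) : bool := (0 < i)%N && p i.

(** Counts the ordered [k]-tuples of disjoint admissible blocks covering an [n]-set; [i] is the size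
    of the first block. *)
Fixpoint ordered_parts (p : pred nat) (k n : nat) : nat :=
  if k is k'.+1 then
    (\sum_(i < n.+1 | block_size p i) 'C(n, i) * ordered_parts p k' (n - i))%N
  else n == 0%N.

Lemma set_parts_in {T : finType} {p} {A B : {set T}} {k P} :
  P \in set_parts p A k -> B \in P -> (B \subset A) && block_size p #|B|.
Proof.
rewrite inE => /and3P[parP _ /forall_inP pP] BP.
rewrite /block_size pP // andbT card_gt0 -(cover_partition parP).
by rewrite (bigcup_max B) //=; apply: contraTneq BP => ->; have /and3P[] := parP.
Qed.

(** Deleting [B] from a partition of [A] is inverse to adding [B] to a partition of [A :\: B]; since
    [B] is nonempty, it is never a block of the latter. *)
Lemma card_set_parts_in (T : finType) p (A B : {set T}) k :
  B \subset A -> block_size p #|B| ->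
  #|[set P in set_parts p A k.+1 | B \in P]| = #|set_parts p (A :\: B) k|.
Proof.
move=> sBA /andP[B0 pB].
have BnP P : P \in set_parts p (A :\: B) k -> B \notin P.
  move=> PP; apply/negP => BP; have /andP[/subsetDP[_ dBB] _] := set_parts_in PP BP.
  by move: dBB B0; rewrite -setI_eq0 setIid => /eqP->; rewrite cards0.
rewrite -[RHS](card_in_imset (f := fun P => B |: P)); last first.
  by move=> P Q PP QQ eqPQ; rewrite -(setU1K (BnP _ PP)) eqPQ (setU1K (BnP _ QQ)).
congr #|pred_of_set _|; apply/setP=> P; rewrite !inE; apply/idP/imsetP.
  move=> /andP[/and3P[parP cP pP] BP]; exists (P :\ B); last by rewrite setD1K.
  rewrite inE partitionD1 //=; move: cP; rewrite (cardsD1 B) BP add1n eqSS => -> /=.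
  by apply/forall_inP => C /setD1P[_ CP]; apply: (forall_inP pP).
move=> [Q QP ->]; have BQ := BnP _ QP; move: QP; rewrite inE => /and3P[parQ cQ pQ].
rewrite setU11 andbT cardsU1 BQ add1n eqSS cQ /=.
apply/andP; split; last first.
  by apply/forall_inP => C /setU1P[->//|]; apply: (forall_inP pQ).
have -> : A = B :|: (A :\: B) by rewrite setDE setUIr setUCr setIT (setUidPr sBA).
apply: partitionU1 => //.
- by rewrite -card_gt0.
- by rewrite -setI_eq0 setIDA setIC -setIDA setDv setI0.
Qed.

(* Double counting of the pairs (P, B) with B a block of P. *)
Lemma card_set_partsS (T : finType) p (A : {set T}) k :
  (k.+1 * #|set_parts p A k.+1| =
   \sum_(B : {set T} | (B \subset A) && block_size p #|B|)
      #|set_parts p (A :\: B) k|)%N.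
Proof.
rewrite mulnC -sum_nat_const.
transitivity (\sum_(P in set_parts p A k.+1)
   \sum_(B : {set T} | (B \subset A) && block_size p #|B|) (B \in P))%N.
  apply: eq_bigr => P PP; have := PP; rewrite inE => /and3P[_ /eqP <- _].
  rewrite -sum1_card [RHS]big_mkcond [LHS]big_mkcond /=; apply: eq_bigr => B _.
  case BP: (B \in P); last by case: ifP.
  by rewrite (set_parts_in PP BP).
rewrite exchange_big /=; apply: eq_bigr => B /andP[sBA pB].
rewrite -card_set_parts_in // -sum1_card big_mkcond [RHS]big_mkcond /=.
by apply: eq_bigr => P _; rewrite !inE; case: ifP.
Qed.

(** Induction on [k]: the double count turns [k.+1] into a choice of one block, and grouping these
    blocks by size produces the binomial coefficients of [ordered_parts]. *)
Lemma fact_card_set_parts (T : finType) p k (A : {set T}) :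
  (k`! * #|set_parts p A k| = ordered_parts p k #|A|)%N.
Proof.
elim: k A => [|k IHk] A.
  rewrite fact0 mul1n /=.
  case: (eqVneq A set0) => [->|A0]; rewrite ?cards0 ?eqxx /=.
    apply: (@eq_card1 _ set0) => P; rewrite !inE.
    apply/and3P/eqP => [[_ /eqP/cards0_eq]//|->].
    rewrite cards0 partition_set0 eqxx; split=> //.
    by apply/forall_inP => B; rewrite inE.
  rewrite cards_eq0 (negbTE A0); apply: eq_card0 => P; rewrite !inE.
  apply/negP => /and3P[parP /eqP/cards0_eq P0 _].
  by move: A0; rewrite -(cover_partition parP) P0 /cover big_set0 eqxx.
rewrite factS -mulnA mulnCA card_set_partsS big_distrr /=.
rewrite (eq_bigr (fun B : {set T} => ordered_parts p k (#|A| - #|B|)%N)); last first.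
  by move=> B /andP[sBA _]; rewrite IHk cardsD (setIidPr sBA).
(* [inord] loses nothing here, since [#|B| <= #|A|] for every [B] in the sum. *)
rewrite (partition_big (fun B : {set T} => inord #|B| : 'I_#|A|.+1)
   (fun i => block_size p i)) /=; last first.
  by move=> B /andP[sBA pB]; rewrite inordK // ltnS subset_leq_card.
apply: eq_bigr => i pi.
rewrite -cards_draws -sum_nat_const; apply: congr_big => //.
  move=> B; rewrite inE; case sBA: (B \subset A) => //=.
  rewrite -val_eqE /= inordK ?ltnS ?subset_leq_card //.
  by case: eqP => [->|]; rewrite ?andbF // pi.
move=> B; rewrite -val_eqE /= => /andP[/andP[sBA _]].
by rewrite inordK ?ltnS ?subset_leq_card // => /eqP->.
Qed.

(** * Powers and composition of power series *)

Fixpoint PS_pow (a : nat -> R) (k : nat) : nat -> R :=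
  match k with
  | O => fun n => match n with O => 1 | S _ => 0 end
  | S k' => PS_mult a (PS_pow a k')
  end.

Lemma PS_pow_lt (a : nat -> R) k n :
  a 0%N = 0 -> (n < k)%N -> PS_pow a k n = 0.
Proof.
move=> a0; elim: k n => [|k IHk] n nk; first by lia.
rewrite /= /PS_mult sum_eq_R0 // => [[|i]] ni; first by rewrite a0 Rmult_0_l.
by rewrite IHk ?Rmult_0_r //; lia.
Qed.

(** The bound is uniform in [k]. It survives the product by [a] because [a 0 = 0] gives
    [sum |a i| 2^-i <= 1 - 2^-n], the sum running over [i <= n]. *)
Lemma PS_pow_bound (a : nat -> R) :
  a 0%N = 0 -> (forall i, Rabs (a i) <= 1) ->
  forall k n, Rabs (PS_pow a k n) <= 2 ^ n.
Proof.
move=> a0 a1; elim=> [|k IHk] n.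
  case: n => [|n] /=; first by rewrite Rabs_R1; lra.
  by rewrite Rabs_R0; apply: Rmult_le_pos; [lra | apply: pow_le; lra].
have sumle : sum_f_R0 (fun i => Rabs (a i) * (/ 2) ^ i) n <= 1 - (/ 2) ^ n.
  elim: n => [|n IHn] /=; first by rewrite a0 Rabs_R0; lra.
  have := a1 n.+1; have : 0 < (/ 2) ^ n by apply: pow_lt; lra.
  nra.
have p2 : 0 < 2 ^ n by apply: pow_lt; lra.
have p2' : 0 < (/ 2) ^ n by apply: pow_lt; lra.
apply: (Rle_trans _ (2 ^ n * sum_f_R0 (fun i => Rabs (a i) * (/ 2) ^ i) n)); last by nra.
rewrite /= /PS_mult; apply: Rle_trans (Rsum_abs _ _) _.
rewrite scal_sum; apply: sum_Rle => i ni.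
rewrite Rabs_mult Rmult_assoc; apply: Rmult_le_compat_l; first exact: Rabs_pos.
apply: Rle_trans (IHk _) _; right.
rewrite pow_inv; have -> : 2 ^ n = 2 ^ (n - i)%coq_nat * 2 ^ i.
  by rewrite -pow_add; congr (2 ^ _); lia.
field; apply: pow_nonzero; lra.
Qed.

Lemma CV_radius_gt (a : nat -> R) (r x : R) :
  0 < r -> (forall n, Rabs (a n) <= r ^ n) -> Rabs x < / r ->
  Rbar_lt (Rabs x) (CV_radius a).
Proof.
move=> r0 ar xr; apply: (Rbar_lt_le_trans _ (Rbar.Finite (/ r))); first exact: xr.
have [ub _] := CV_radius_bounded a; apply: ub; exists 1 => n.
rewrite pow_inv Rabs_mult Rabs_inv (Rabs_pos_eq (r ^ n)); last by apply: pow_le; lra.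
have rn : 0 < r ^ n by apply: pow_lt.
apply: (Rmult_le_reg_r (r ^ n)) => //.
by rewrite Rmult_assoc Rinv_l ?Rmult_1_l ?Rmult_1_r //; lra.
Qed.

(** The Cauchy product needs [t] strictly inside both discs of convergence; the bound [2^n] on the
    coefficients of the powers explains [/ 2]. *)
Lemma is_pseries_pow (a : nat -> R) (t u : R) k :
  a 0%N = 0 -> (forall i, Rabs (a i) <= 1) -> Rabs t < / 2 ->
  is_pseries a t u -> is_pseries (PS_pow a k) t (u ^ k).
Proof.
move=> a0 a1 t2 ha; elim: k => [|k IHk] /=.
  apply/is_pseries_R.
  apply: (is_series_decr_n _ 1) => //.
  rewrite sum_O /= Rmult_1_l plus_opp_r.
  apply: (is_series_ext (fun=> 0)) => [n|]; first by rewrite Rmult_0_l.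
  rewrite -/zero /=; apply: filterlim_ext (filterlim_const _) => n.
  by rewrite sum_n_const Rmult_0_r.
apply: is_pseries_mult => //; last by apply: (CV_radius_gt _ 2) => //; [lra | apply: PS_pow_bound].
apply: (CV_radius_gt _ 1); [lra | move=> n; rewrite pow1; exact: a1 | lra].
Qed.

(** The terms are at most [2^n 8^-n = 4^-n], so a geometric series dominates the tail. The estimate
    depends on [a] only through the bound [2^n], hence serves all powers of a series at once. *)
Lemma pseries_tail (a : nat -> R) (t l : R) N :
  (forall n, Rabs (a n) <= 2 ^ n) -> Rabs t <= / 8 -> is_pseries a t l ->
  Rabs (l - sum_f_R0 (fun n => a n * t ^ n) N) <= (/ 4) ^ N.
Proof.
move=> a2 t8 /is_pseries_R ha.
have bnd n : Rabs (a n * t ^ n) <= (/ 4) ^ n.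
  rewrite Rabs_mult -RPow_abs; apply: Rle_trans (_ : 2 ^ n * (/ 8) ^ n <= _); last first.
    by right; rewrite -Rpow_mult_distr; congr (_ ^ _); field.
  apply: Rmult_le_compat => //; [exact: Rabs_pos | by apply: pow_le; exact: Rabs_pos |].
  by apply: pow_incr; split=> //; exact: Rabs_pos.
have tail : is_series (fun k => a (N.+1 + k)%N * t ^ (N.+1 + k))
    (l - sum_f_R0 (fun n => a n * t ^ n) N).
  apply: (is_series_incr_n (fun n => a n * t ^ n) N.+1); first lia.
  rewrite sum_n_Reals /=; move: ha; congr (is_series _ _).
  by rewrite /plus /=; lra.
have geo : is_series (fun k => (/ 4) ^ N.+1 * (/ 4) ^ k) ((/ 4) ^ N.+1 * / (1 - / 4)).
  apply: (is_series_scal_l ((/ 4) ^ N.+1)); apply: is_series_geom.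
  by rewrite Rabs_pos_eq; lra.
have le k : Rabs (a (N.+1 + k)%N * t ^ (N.+1 + k)) <= (/ 4) ^ N.+1 * (/ 4) ^ k.
  by rewrite -pow_add; apply: bnd.
rewrite -(is_series_unique _ _ tail).
have exabs : ex_series (fun k => Rabs (a (N.+1 + k)%N * t ^ (N.+1 + k))).
  apply: (@ex_series_le _ R_CompleteNormedModule _ (fun k => (/ 4) ^ N.+1 * (/ 4) ^ k)).
    by move=> k; rewrite /norm /= /abs /= Rabs_Rabsolu; apply: le.
  by exists ((/ 4) ^ N.+1 * / (1 - / 4)).
apply: Rle_trans (Series_Rabs _ exabs) _.
apply: (Rle_trans _ ((/ 4) ^ N.+1 * / (1 - / 4))); last first.
  by have : 0 < (/ 4) ^ N by [apply: pow_lt; lra]; rewrite /=; lra.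
rewrite -(is_series_unique _ _ geo); apply: Series_le.
  by move=> k; split; [exact: Rabs_pos | apply: le].
by exists ((/ 4) ^ N.+1 * / (1 - / 4)).
Qed.

(** Coefficients of the composite series. Stopping at [k = n] is correct when [a 0 = 0], since the
    [k]-th power then starts in degree [k] at least. *)
Definition PS_comp (c a : nat -> R) (n : nat) : R :=
  sum_f_R0 (fun k => c k * PS_pow a k n) n.

(** The inner sums over [k <= n] are padded with zeros up to [N], after which the two finite sums
    are exchanged. *)
Lemma sum_triangle_square (f : nat -> nat -> R) N :
  (forall k n, (n < k)%N -> f k n = 0) ->
  sum_f_R0 (fun n => sum_f_R0 (fun k => f k n) n) N =
  sum_f_R0 (fun k => sum_f_R0 (fun n => f k n) N) N.
Proof.
move=> f0; rewrite -!sum_n_Reals.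
transitivity (sum_n (fun n => sum_n (fun k => f k n) N) N); last first.
  rewrite (sum_n_switch (fun n k => f k n)).
  by apply: sum_n_ext => k; rewrite sum_n_Reals.
apply: sum_n_ext_loc => n nN; rewrite sum_n_Reals.
have {nN} : (n <= N)%N by lia.
elim: N => [|N IHN]; first by case: n.
rewrite leq_eqVlt => /orP[/eqP->//|nN].
by rewrite /= IHN // f0 // Rplus_0_r.
Qed.

(** Rather than exchanging two infinite sums, the proof compares the partial sums of both series at
    the same [N] and shows that their difference tends to [0]. *)
Lemma is_pseries_comp (c a : nat -> R) (t u v : R) :
  a 0%N = 0 -> (forall i, Rabs (a i) <= 1) -> (forall i, Rabs (c i) <= 1) ->
  Rabs t <= / 8 -> is_pseries a t u -> is_pseries c u v ->
  is_pseries (PS_comp c a) t v.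
Proof.
move=> a0 a1 c1 t8 ha /is_pseries_R hc; apply/is_pseries_R.
have part N : sum_n (fun n => PS_comp c a n * t ^ n) N =
    sum_f_R0 (fun k => c k * sum_f_R0 (fun n => PS_pow a k n * t ^ n) N) N.
  rewrite sum_n_Reals.
  transitivity (sum_f_R0 (fun n => sum_f_R0 (fun k => c k * PS_pow a k n * t ^ n) n) N).
    by apply: PartSum.sum_eq => n _; rewrite /PS_comp Rmult_comm scal_sum; apply: PartSum.sum_eq.
  rewrite (sum_triangle_square (fun k n => c k * PS_pow a k n * t ^ n)); last first.
    by move=> k n nk; rewrite PS_pow_lt // Rmult_0_r Rmult_0_l.
  apply: PartSum.sum_eq => k _; rewrite scal_sum; apply: PartSum.sum_eq => n _; ring.
(* The difference is a combination of [N + 1] tails, each at most [4^-N], and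
   [(N + 1) 4^-N <= 2^-N]. *)
have err N : Rabs (sum_n (fun n => PS_comp c a n * t ^ n) N - sum_n (fun k => c k * u ^ k) N)
    <= (/ 2) ^ N.
  rewrite part sum_n_Reals -minus_sum; apply: Rle_trans (Rsum_abs _ _) _.
  apply: (Rle_trans _ (sum_f_R0 (fun=> (/ 4) ^ N) N)).
    apply: sum_Rle => k _.
    rewrite -Rmult_minus_distr_l Rabs_mult Rabs_minus_sym -[X in _ <= X]Rmult_1_l.
    apply: Rmult_le_compat; rewrite ?c1 //; try exact: Rabs_pos.
    apply: pseries_tail => //; first exact: PS_pow_bound.
    by apply: is_pseries_pow => //; lra.
  rewrite sum_cte.
  have -> : (/ 4) ^ N = (/ 2) ^ N * (/ 2) ^ N.
    by rewrite -Rpow_mult_distr; congr (_ ^ _); field.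
  have p : 0 < (/ 2) ^ N by apply: pow_lt; lra.
  have q : (/ 2) ^ N * INR N.+1 <= 1; last by nra.
  elim: N {part p} => [|N IHN]; first by rewrite /=; lra.
  have : 1 <= INR N.+1 by apply: (le_INR 1); lia.
  have : 0 < (/ 2) ^ N by apply: pow_lt; lra.
  by rewrite (S_INR N.+1) [_ ^ N.+1]/=; nra.
have lim0 : is_lim_seq (fun N => sum_n (fun n => PS_comp c a n * t ^ n) N
     - sum_n (fun k => c k * u ^ k) N) 0.
  apply/is_lim_seq_abs_0; apply: (is_lim_seq_le_le (fun=> 0) _ (fun N => (/ 2) ^ N)).
  - by move=> N; split; [exact: Rabs_pos | exact: err].
  - exact: is_lim_seq_const.
  - by apply: is_lim_seq_geom; rewrite Rabs_pos_eq; lra.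
have := is_lim_seq_plus' _ _ _ _ lim0 hc.
rewrite Rplus_0_l; apply: is_lim_seq_ext => N.
have subK (x y : R) : x - y + y = x by ring.
exact: subK.
Qed.

(** * Polylogarithms and iterated integrals *)

(* Shifted index: [x * PSeries (polylog_coef j) x] is [Li_j(x)]. *)
Definition polylog_coef (j n : nat) : R := / INR (n + 1) ^ j.

Lemma polylog_coef_le1 j n : Rabs (polylog_coef j n) <= 1.
Proof.
have n1 : 1 <= INR (n + 1) by apply: (le_INR 1); lia.
have nj : 1 <= INR (n + 1) ^ j by apply: pow_R1_Rle.
rewrite /polylog_coef Rabs_pos_eq; last by left; apply: Rinv_0_lt_compat; lra.
by rewrite -Rinv_1; apply: Rinv_le_contravar; lra.
Qed.

Lemma CV_radius_polylog j x : Rabs x < 1 -> Rbar_lt (Rabs x) (CV_radius (polylog_coef j)).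
Proof.
move=> x1; apply: (CV_radius_gt _ 1); [lra | | lra].
by move=> n; rewrite pow1; apply: polylog_coef_le1.
Qed.

(** This is the rule [Li_{j+1}'(x) = Li_j(x) / x], with the quotient written as a power series so
    that it also makes sense at [0]. *)
Lemma is_derive_polylog j x :
  Rabs x < 1 ->
  is_derive (fun y => y * PSeries (polylog_coef j.+1) y) x (PSeries (polylog_coef j) x).
Proof.
move=> x1; apply: (is_derive_ext (PSeries (PS_incr_1 (polylog_coef j.+1)))).
  by move=> y; rewrite PSeries_incr_1.
have -> : PSeries (polylog_coef j) x = PSeries (PS_derive (PS_incr_1 (polylog_coef j.+1))) x.
  apply: PSeries_ext => n; rewrite /PS_derive /= /polylog_coef /= addn1.
  have n0 : INR n.+1 <> 0 by apply: not_0_INR.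
  by rewrite -/(INR n.+1); field; split=> //; apply: pow_nonzero.
by apply: is_derive_PSeries; rewrite CV_radius_incr_1; apply: CV_radius_polylog.
Qed.

Lemma polylog0 x : Rabs x < 1 -> PSeries (polylog_coef 0) x = / (1 - x).
Proof.
move=> x1; apply: is_pseries_unique; apply/is_pseries_R.
apply: is_series_ext (is_series_geom _ x1) => n.
by rewrite /polylog_coef /=; field.
Qed.

(** Both sides vanish at [0] and have derivative [1 / (1 - x)], so the mean value theorem on the
    segment from [0] to [x] identifies them. *)
Lemma polylog1 x : Rabs x < 1 -> x * PSeries (polylog_coef 1) x = - ln (1 - x).
Proof.
move=> x1.
have seg y : Rmin 0 x <= y <= Rmax 0 x -> Rabs y < 1.
  move: x1; rewrite /Rmin /Rmax /Rabs; case: Rle_dec; case: Rcase_abs; case: Rcase_abs; lra.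
pose f y := y * PSeries (polylog_coef 1) y + ln (1 - y).
have df y : Rabs y < 1 -> is_derive f y 0.
  move=> y1; have y1' : 0 < 1 - y by move: y1; rewrite /Rabs; case: Rcase_abs; lra.
  have -> : 0 = plus (PSeries (polylog_coef 0) y) (- / (1 - y)).
    by rewrite polylog0 // /plus /=; ring.
  apply: (is_derive_plus (fun y => y * PSeries (polylog_coef 1) y) (fun y => ln (1 - y))).
    exact: is_derive_polylog.
  by auto_derive; [lra | field; lra].
have [|y /seg/df dy|y [_]] := MVT_gen f 0 x (fun=> 0).
- move=> y y0; apply: df; apply: seg; lra.
- apply: (continuity_pt_filterlim f y).2.
  by apply: (ex_derive_continuous f y); exists 0.
by rewrite /f Rminus_0_r ln_1; lra.
Qed.

(** By induction the integrand is [du] times [Li_{j+1}(u) / u], the derivative of [Li_{j+2}(u)]; the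
    lower endpoint contributes nothing because [u 0 = 0]. *)
Lemma iterated_polylog (u du : R -> R) (H : nat -> R -> R) (d : R) :
  u 0 = 0 ->
  (forall t, Rabs t < d -> Rabs (u t) < 1) ->
  (forall t, is_derive u t (du t)) -> (forall t, continuous du t) ->
  (forall t, t <> 0 -> Rabs t < d -> u t <> 0) ->
  (forall t, H 1%N t = - ln (1 - u t)) ->
  (forall j t, H j.+2 t = RInt (fun s => du s / u s * H j.+1 s) 0 t) ->
  forall j t, Rabs t < d -> H j.+1 t = u t * PSeries (polylog_coef j.+1) (u t).
Proof.
move=> u0 u1 du_u cdu un0 H1 HS; elim=> [|j IHj] t td.
  by rewrite H1 polylog1 //; apply: u1.
have seg s : Rmin 0 t <= s <= Rmax 0 t -> Rabs s < d.
  move: td; rewrite /Rmin /Rmax /Rabs; case: Rle_dec; case: Rcase_abs; case: Rcase_abs; lra.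
rewrite HS.
(* Agreement is required only strictly between [0] and [t], so the removable singularity at [0] is
   avoided. *)
rewrite (RInt_ext _ (fun s => du s * PSeries (polylog_coef j.+1) (u s))); last first.
  move=> s s0t; have sd : Rabs s < d by apply: seg; lra.
  have cancel_den (x y z : R) : y <> 0 -> x / y * (y * z) = x * z by move=> ?; field.
  rewrite IHj //; apply: cancel_den; apply: un0 => //.
  by move: s0t; rewrite /Rmin /Rmax; case: Rle_dec; lra.
rewrite (is_RInt_unique _ _ _ _ (is_RInt_derive
  (fun s => u s * PSeries (polylog_coef j.+2) (u s)) _ _ _ _ _)).
- by rewrite /minus /plus /opp /= u0; ring.
- move=> s /seg sd.
  apply: (is_derive_comp (fun y => y * PSeries (polylog_coef j.+2) y) u) => //.
  by apply: is_derive_polylog; apply: u1.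
- move=> s /seg sd; apply: (continuous_mult du) => //.
  apply: (continuous_comp u (PSeries _)).
    by apply: (ex_derive_continuous u); exists (du s).
  apply/continuity_pt_filterlim; apply: PSeries_continuity.
  by apply: CV_radius_polylog; apply: u1.
Qed.

(** * Generating function of the admissible block sizes and its powers *)

(** Coefficients of [u(t) = - sum (-t)^i / i!], the sum running over the admissible sizes [i]. *)
Definition blocks_coef (p : pred nat) (i : nat) : R :=
  if block_size p i then - (-1) ^ i / INR (fact i) else 0.

Lemma blocks_coef_le1 p i : Rabs (blocks_coef p i) <= 1.
Proof.
rewrite /blocks_coef; case: block_size; last by rewrite Rabs_R0; lra.
have f1 : 1 <= INR (fact i) by apply: (le_INR 1); have := lt_O_fact i; lia.
rewrite Rabs_mult Rabs_Ropp pow_1_abs Rmult_1_l Rabs_inv Rabs_pos_eq; last lra.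
by rewrite -Rinv_1; apply: Rinv_le_contravar; lra.
Qed.

Lemma INR_sum_ord n (P : pred nat) (f : nat -> nat) :
  INR (\sum_(i < n.+1 | P i) f i) = sum_f_R0 (fun i => if P i then INR (f i) else 0) n.
Proof.
rewrite big_mkcond /=; elim: n => [|n IHn].
  by rewrite big_ord_recr big_ord0 /= add0n; case: (P _).
by rewrite big_ord_recr /= plus_INR IHn; case: (P _).
Qed.

Lemma factorial_fact n : n`! = fact n.
Proof. by elim: n => // n IHn; rewrite factS IHn. Qed.

(** The recursion of [ordered_parts] is the Cauchy product once [C(n, i)] is split into factorials.
    Each of the [k] factors contributes a sign [-1], and the exponents [i] of [(-1)^i] add up to
    [n]. *)
Lemma PS_pow_blocks_coef p k n :
  PS_pow (blocks_coef p) k n =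
  (-1) ^ k * (-1) ^ n * INR (ordered_parts p k n) / INR (fact n).
Proof.
elim: k n => [|k IHk] n.
  by case: n => [|n] /=; rewrite /Rdiv; [field | ring].
rewrite [LHS]/= /PS_mult [ordered_parts _ _ _]/=.
rewrite (INR_sum_ord n (block_size p) (fun i => 'C(n, i) * ordered_parts p k (n - i))%N).
have fn0 i : INR (fact i) <> 0 by apply: INR_fact_neq_0.
rewrite /Rdiv Rmult_comm -Rmult_assoc scal_sum.
apply: PartSum.sum_eq => i ni; rewrite IHk /blocks_coef.
case: block_size; last by ring.
have := bin_fact (n := n) (m := i); rewrite !factorial_fact => bin.
have {bin} := f_equal INR (bin ltac:(lia)); rewrite !mult_INR => bin.
have -> : INR 'C(n, i) = INR (fact n) / (INR (fact i) * INR (fact (n - i)%N)).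
  by rewrite -bin; field.
have -> : (-1) ^ n = (-1) ^ i * (-1) ^ (n - i)%coq_nat.
  by rewrite -pow_add; congr (_ ^ _); lia.
rewrite -[(-1) ^ k.+1]/(-1 * (-1) ^ k) -![(n - i)%coq_nat]/(n - i)%N.
by field.
Qed.

Lemma blocks_coef_PS_comp p j n :
  PS_comp (polylog_coef j) (blocks_coef p) n =
  sum_n (fun k => (-1) ^ (n - k) * (INR (fact k) / INR (k + 1) ^ j)
     * INR #|set_parts p [set: 'I_n] k|) n / INR (fact n).
Proof.
rewrite sum_n_Reals /Rdiv Rmult_comm scal_sum; apply: PartSum.sum_eq => k kn.
have -> : PS_pow (blocks_coef p) k n = (-1) ^ k * (-1) ^ n *
    (INR (fact k) * INR #|set_parts p [set: 'I_n] k|) / INR (fact n).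
  rewrite PS_pow_blocks_coef; congr (_ * _ / _).
  rewrite -{1}(card_ord n) -cardsT -fact_card_set_parts mult_INR factorial_fact.
  by [].
rewrite /polylog_coef.
(* Here [k <= n], so the subtraction is exact; the two factors [(-1)^k] then cancel and leave the
   sign [(-1)^(n-k)]. *)
have -> : (-1) ^ n = (-1) ^ (n - k) * (-1) ^ k.
  by rewrite -pow_add; congr (_ ^ _); lia.
have sq : (-1) ^ k * (-1) ^ k = 1 
  by rewrite -Rpow_mult_distr (_ : -1 * -1 = 1) ?pow1 //; ring.
transitivity ((-1) ^ k * (-1) ^ k * (/ INR (k + 1) ^ j * (-1) ^ (n - k) *
  (INR (fact k) * INR #|set_parts p [set: 'I_n] k|) / INR (fact n))); first by rewrite /Rdiv; ring.
by rewrite sq /Rdiv; ring.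
Qed.

(** Factoring out [t^d] leaves a series that is continuous at [0] with value [a d], hence nonzero
    nearby. *)
Lemma PSeries_neq0_near0 (a : nat -> R) d :
  (forall i, Rabs (a i) <= 1) -> (forall i, (i < d)%N -> a i = 0) -> a d <> 0 ->
  locally 0 (fun t => t <> 0 -> PSeries a t <> 0).
Proof.
move=> a1 alt ad.
have c : continuous (PSeries (PS_decr_n a d)) 0.
  apply/continuity_pt_filterlim; apply: PSeries_continuity.
  apply: (CV_radius_gt _ 1); [lra | | rewrite Rabs_R0; lra].
  by move=> n; rewrite pow1; apply: a1.
have v0 : PSeries (PS_decr_n a d) 0 = a d by rewrite PSeries_0 /PS_decr_n Nat.add_0_r.
have near_n0 : locally 0 (fun t => PSeries (PS_decr_n a d) t <> 0).
  by apply: (c (fun y => y <> 0)); apply: open_neq; rewrite v0.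
apply: filter_imp near_n0 => t tn0 t0; rewrite (PSeries_decr_n_aux a d).
  by apply: Rmult_integral_contrapositive_currified => //; apply: pow_nonzero.
by move=> k kd; apply: alt; lia.
Qed.

Lemma ball0E (e t : R) : ball 0 e t = (Rabs t < e).
Proof.
by rewrite /ball /= /AbsRing_ball /= /abs /minus /plus /opp /= Ropp_0 Rplus_0_r.
Qed.

(* [d] is the least admissible block size: it makes [u t] nonzero for small [t <> 0]. *)
Lemma poly_Bernoulli_gf (p : pred nat) (d : nat) (u du : R -> R) (H : nat -> R -> R) mu :
  block_size p d -> (forall i, (i < d)%N -> ~~ block_size p i) ->
  (forall t, is_pseries (blocks_coef p) t (u t)) ->
  (forall t, is_derive u t (du t)) -> (forall t, continuous du t) ->
  (forall t, H 1%N t = - ln (1 - u t)) ->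
  (forall j t, H j.+2 t = RInt (fun s => du s / u s * H j.+1 s) 0 t) ->
  (1 <= mu)%N ->
  locally' 0 (fun t =>
    is_pseries (fun n => sum_n (fun k => (-1) ^ (n - k) * (INR (fact k) / INR (k + 1) ^ mu)
     * INR #|set_parts p [set: 'I_n] k|) n / INR (fact n)) t (H mu t / u t)).
Proof.
move=> pd plt hu du_u cdu H1 HS; case: mu => // j _.
have a0 : blocks_coef p 0 = 0 by [].
have u0 : u 0 = 0 by rewrite -(is_pseries_unique _ _ _ (hu 0)) PSeries_0.
have near_un0 : locally 0 (fun t => t <> 0 -> u t <> 0).
  apply: (filter_imp (fun t => t <> 0 -> PSeries (blocks_coef p) t <> 0)).
    by move=> t; rewrite (is_pseries_unique _ _ _ (hu t)).
  apply: (PSeries_neq0_near0 _ d); first exact: blocks_coef_le1.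
    by move=> i /plt; rewrite /blocks_coef; case: block_size.
  rewrite /blocks_coef pd; apply: Rmult_integral_contrapositive_currified.
    by apply: Ropp_neq_0_compat; apply: pow_nonzero; lra.
  by apply: Rinv_neq_0_compat; apply: INR_fact_neq_0.
have near_u1 : locally 0 (fun t => Rabs (u t) < 1).
  have cu : continuous u 0 by apply: (ex_derive_continuous u); exists (du 0).
  apply: (cu (fun y => Rabs y < 1)); rewrite u0.
  by exists (mkposreal 1 Rlt_0_1) => y; rewrite ball0E.
have [e he] := filter_and _ _ near_un0 near_u1.
have ball0 t : Rabs t < e -> ball 0 e t by rewrite ball0E.
have key := iterated_polylog u du H e u0 (fun t te => proj2 (he t (ball0 t te))) du_u cdu
  (fun t t0 te => proj1 (he t (ball0 t te)) t0) H1 HS.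
(* Within [e] the polylogarithm formula for [H] holds and [u] vanishes at most at [0]; [/ 8] is the
   radius allowed by [is_pseries_comp]. *)
have d0 : 0 < Rmin e (/ 8) by apply: Rmin_glb_lt; [exact: cond_pos | lra].
exists (mkposreal _ d0) => t; rewrite ball0E /= => td t0.
have te : Rabs t < e by apply: Rlt_le_trans td (Rmin_l _ _).
have t8 : Rabs t <= / 8 by left; apply: Rlt_le_trans td (Rmin_r _ _).
have [un0 u1] := he t (ball0 t te).
rewrite key //; have -> : u t * PSeries (polylog_coef j.+1) (u t) / u t =
  PSeries (polylog_coef j.+1) (u t) by field; apply: un0.
apply: (is_pseries_ext (PS_comp (polylog_coef j.+1) (blocks_coef p))).
  by move=> n; rewrite blocks_coef_PS_comp.
apply: (is_pseries_comp _ _ _ (u t)) => //.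
- exact: blocks_coef_le1.
- exact: polylog_coef_le1.
- by apply: PSeries_correct; apply: CV_radius_inside; apply: CV_radius_polylog.
Qed.

(** * Truncated exponentials *)

Lemma Epoly_nat (n : nat) t :
  Epoly (Z.of_nat n) t = sum_n (fun k => t ^ k / INR (fact k)) n.
Proof. by rewrite /Epoly Nat2Z.id; case: Z.ltb_spec => //; lia. Qed.

Lemma Epoly_lt0 z t : (z < 0)%Z -> Epoly z t = 0.
Proof. by move=> z0; rewrite /Epoly; case: Z.ltb_spec => //; lia. Qed.

(** The term added at degree [n + 1] has derivative [t^n / n!], which completes [E_{n-1}] to [E_n].
    The zero convention at negative indices starts the induction and covers [E_{m-2}] for
    [m = 1]. *)
Lemma is_derive_Epoly z t : is_derive (Epoly z) t (Epoly (z - 1) t).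
Proof.
case: (Z_lt_le_dec z 0) => z0.
  rewrite Epoly_lt0; last lia.
  apply: (is_derive_ext (fun=> 0)); first by move=> x; rewrite Epoly_lt0.
  exact: is_derive_const.
rewrite -(Z2Nat.id z z0); elim: (Z.to_nat z) => [|n IHn].
  rewrite Epoly_lt0 //; apply: (is_derive_ext (fun=> 1)).
    by move=> x; rewrite Epoly_nat sum_O /=; field.
  exact: is_derive_const.
have -> : (Z.of_nat n.+1 - 1 = Z.of_nat n)%Z by lia.
apply: (is_derive_ext (fun x => Epoly (Z.of_nat n) x + x ^ n.+1 / INR (fact n.+1))).
  by move=> x; rewrite !Epoly_nat sum_Sn.
have -> : Epoly (Z.of_nat n) t = plus (Epoly (Z.of_nat n - 1) t) (t ^ n / INR (fact n)).
  case: n {IHn} => [|n].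
    by rewrite Epoly_nat Epoly_lt0 // sum_O /plus /=; field.
  have -> : (Z.of_nat n.+1 - 1 = Z.of_nat n)%Z by lia.
  by rewrite !Epoly_nat sum_Sn.
apply: (is_derive_plus (Epoly (Z.of_nat n))) => //.
auto_derive => //; rewrite -/(INR n.+1) plus_INR mult_INR S_INR.
have := pos_INR n; have := INR_fact_neq_0 n.
move=> fn0 n0; field; split => //; nra.
Qed.

Lemma is_derive_Epoly_opp z t :
  is_derive (fun s => Epoly z (- s)) t (- Epoly (z - 1) (- t)).
Proof.
have -> : - Epoly (z - 1) (- t) = scal (-1) (Epoly (z - 1) (- t)).
  by rewrite /scal /= /mult /=; ring.
apply: (is_derive_comp (Epoly z) Ropp); first exact: is_derive_Epoly.
by auto_derive.
Qed.

Lemma continuous_Epoly_opp z t : continuous (fun s => Epoly z (- s)) t.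
Proof.
apply: (ex_derive_continuous (fun s => Epoly z (- s))).
by eexists; apply: is_derive_Epoly_opp.
Qed.

Lemma is_pseries_exp_opp t : is_pseries (fun i => (-1) ^ i / INR (fact i)) t (exp (- t)).
Proof.
apply/is_pseries_R; have /is_pseries_R := is_exp_Reals (- t).
apply: is_series_ext => n; have -> : - t = -1 * t by ring.
by rewrite Rpow_mult_distr -Rmult_assoc [/ _ * _]Rmult_comm.
Qed.

Lemma is_pseries_Epoly_opp (m : nat) t :
  is_pseries (fun i => if (i <= m)%N then (-1) ^ i / INR (fact i) else 0) t
    (Epoly (Z.of_nat m) (- t)).
Proof.
apply/is_pseries_R.
have sum_trunc N : (m <= N)%N ->
    sum_n (fun i => (if (i <= m)%N then (-1) ^ i / INR (fact i) else 0) * t ^ i) N =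
    Epoly (Z.of_nat m) (- t).
  rewrite Epoly_nat; elim: N => [|N IHN] mN.
    have -> : m = 0%N by lia.
    by rewrite !sum_O /=; field.
  case: (ltnP N m) => [Nm|mN'].
    have -> : N.+1 = m by lia.
    apply: sum_n_ext_loc => i im; have -> : (i <= m)%N by lia.
    have -> : - t = -1 * t by ring.
    by rewrite Rpow_mult_distr /Rdiv Rmult_assoc [/ _ * _]Rmult_comm -Rmult_assoc.
  rewrite sum_Sn IHN //; have -> : (N < m)%N = false by lia.
  by rewrite Rmult_0_l plus_zero_r.
(* The partial sums are constant from rank [m] on. *)
apply: (filterlim_ext_loc (fun=> Epoly (Z.of_nat m) (- t))); last exact: filterlim_const.
by exists m => N mN; rewrite sum_trunc //; lia.
Qed.

Theorem theorem2 (mu m : nat) (hmu : (1 <= mu)%N) (hm : (1 <= m)%N) :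
  locally' 0 (fun t : R =>
    is_pseries (fun n : nat => Bernoulli_le m mu n / INR (fact n)) t
      (Fres m mu t / (1 - Epoly (Z.of_nat m) (- t))))
  /\
  locally' 0 (fun t : R =>
    is_pseries (fun n : nat => Bernoulli_ge m mu n / INR (fact n)) t
      (Gassoc m mu t / (Epoly (Z.of_nat m - 1) (- t) - exp (- t)))).
Proof.
split.
(* The least admissible size is [1]. [part_le] is an instance of [set_parts] by unfolding, and the
   recursion for [Fres] holds by computation. *)
- apply: (poly_Bernoulli_gf (fun j => (j <= m)%N) 1
    (fun t => 1 - Epoly (Z.of_nat m) (- t)) (fun t => Epoly (Z.of_nat m - 1) (- t))
    (Fres m)) => //.
  + by case.
  (* Writing [1] as [E_0(-t)] makes the difference cancel in degree [0], leaving exactly the sizes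
     from [1] to [m]. *)
  + move=> t; have -> : 1 - Epoly (Z.of_nat m) (- t) =
        minus (Epoly (Z.of_nat 0) (- t)) (Epoly (Z.of_nat m) (- t)).
      by rewrite [Epoly (Z.of_nat 0) _]Epoly_nat sum_O /minus /plus /opp /=; field.
    apply: is_pseries_ext (is_pseries_minus _ _ _ _ _
      (is_pseries_Epoly_opp 0 t) (is_pseries_Epoly_opp m t)) => i.
    rewrite /PS_minus /PS_plus /PS_opp /blocks_coef /block_size /plus /opp /=.
    by case: i => [|i] /=; [field | case: ifP => _; rewrite /Rdiv; ring].
  + move=> t; rewrite -[Epoly _ _]Ropp_involutive -[- - _]Rplus_0_l.
    apply: (is_derive_minus (fun=> 1) (fun s => Epoly (Z.of_nat m) (- s))).
      exact: is_derive_const.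
    exact: is_derive_Epoly_opp.
  + exact: continuous_Epoly_opp.
  + by move=> t; congr (- ln _); ring.
have m1 : (Z.of_nat m - 1)%Z = Z.of_nat m.-1 by lia.
apply: (poly_Bernoulli_gf (fun j => (m <= j)%N) m
  (fun t => Epoly (Z.of_nat m - 1) (- t) - exp (- t))
  (fun t => exp (- t) - Epoly (Z.of_nat m - 2) (- t)) (Gassoc m)) => //.
- by rewrite /block_size leqnn hm.
- by move=> i im; rewrite /block_size [(m <= i)%N]leqNgt im andbF.
- move=> t; rewrite m1; apply: is_pseries_ext (is_pseries_minus _ _ _ _ _
    (is_pseries_Epoly_opp m.-1 t) (is_pseries_exp_opp t)) => i.
  rewrite /PS_minus /PS_plus /PS_opp /blocks_coef /block_size /plus /opp /=.
  (* As [m >= 1], the admissible sizes are the complement of [i <= m - 1]: the exponential series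
     minus its truncation. *)
  have -> : (0 < i)%N && (m <= i)%N = ~~ (i <= m.-1)%N by lia.
  by case: ifP => _ /=; rewrite /Rdiv; ring.
- move=> t; have -> : exp (- t) - Epoly (Z.of_nat m - 2) (- t) =
      minus (- Epoly (Z.of_nat m - 1 - 1) (- t)) (- exp (- t)).
    have -> : (Z.of_nat m - 1 - 1 = Z.of_nat m - 2)%Z by lia.
    by rewrite /minus /plus /opp /=; ring.
  apply: (is_derive_minus (fun s => Epoly _ (- s)) (fun s => exp (- s))).
    exact: is_derive_Epoly_opp.
  by auto_derive => //; ring.
- move=> t; apply: (continuous_minus (fun s => exp (- s)) (fun s => Epoly _ (- s))).
    by apply: (ex_derive_continuous (fun s => exp (- s))); auto_derive.
  exact: continuous_Epoly_opp.
- by move=> t; congr (- ln _); ring.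
Qed.
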